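(* Let $\hbar>0$. Then $$\int_{-\infty}^{+\infty}e^{-\frac{1}{4\hbar}x^4+\frac{1}{2\hbar}x^2}\,dx=\mathcal{C}_1(\hbar)\cdot\frac{\sqrt{\hbar^{\frac12}\,2^{\frac12}\,\pi^{\frac32}}}{\mathrm{AGM}(\sqrt2,1)^{\frac12}},$$ where $$\mathcal{C}_1(\hbar)=\sum_{n=0}^{+\infty}\frac{1}{\hbar^{\frac n2}\,n!}\sqrt{\frac{(2n)!}{2^{3n}\,n!}\;\prod_{k=1}^{+\infty}\frac{\left(k-\frac12\right)(2n+4k-1)}{k\,(2n+4k-3)}\;\prod_{l=1}^{+\infty}\frac{2l\,(4l-3)}{(2l-1)(4l-1)}}\,.$$
   Context: For positive reals $a,b$, $\mathrm{AGM}(a,b)$ denotes the arithmetic-geometric mean: the common limit of the sequences $a_0=a$, $b_0=b$, $a_{j+1}=\frac{a_j+b_j}{2}$, $b_{j+1}=\sqrt{a_jb_j}$. In the definition of $\mathcal{C}_1(\hbar)$, the square root covers the factor $\frac{(2n)!}{2^{3n}n!}$ and both infinite products, and the infinite products are limits of their partial products. *)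

(* Defs.v *)
From mathcomp Require Export all_boot all_order all_algebra.
From mathcomp Require Export all_classical all_reals all_analysis.
From mathcomp Require Import ring lra.

Set Implicit Arguments.
Unset Strict Implicit.
Unset Printing Implicit Defensive.

Import Order.TTheory GRing.Theory Num.Theory.
Import numFieldNormedType.Exports.

Local Open Scope classical_set_scope.
Local Open Scope ring_scope.

Fixpoint agm_seq {R : realType} (a b : R) (j : nat) : R * R :=
  if j is j'.+1 then
    let: (a', b') := agm_seq a b j' in ((a' + b') / 2, Num.sqrt (a' * b'))
  else (a, b).

(* [agm_cvg] below shows that, for positive [a] and [b], this is the limit of
   both components of [agm_seq a b]. *)
Definition AGM {R : realType} (a b : R) : R :=
  limn (fun j => (agm_seq a b j).1).

Definition partial_prod {R : realType} (u : nat -> R) (N : nat) : R :=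
  \prod_(1 <= k < N.+1) u k.

Definition infprod {R : realType} (u : nat -> R) : R := limn (partial_prod u).

Definition prodk_factor {R : realType} (n k : nat) : R :=
  ((k%:R - 2^-1) * (2 * n%:R + 4 * k%:R - 1)) /
  (k%:R * (2 * n%:R + 4 * k%:R - 3)).

Definition prodl_factor {R : realType} (l : nat) : R :=
  (2 * l%:R * (4 * l%:R - 3)) / ((2 * l%:R - 1) * (4 * l%:R - 1)).

Definition C1_term {R : realType} (h : R) (n : nat) : R :=
  1 / (h `^ (n%:R / 2) * n`!%:R) *
  Num.sqrt ((2 * n)%N`!%:R / (2 ^+ (3 * n)%N * n`!%:R) *
            infprod (prodk_factor n) * infprod prodl_factor).

Definition C1 {R : realType} (h : R) : R := limn (series (C1_term h)).

Lemma agm_step {R : realType} (x y : R) : 0 < x -> 0 < y ->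
  let s := Num.sqrt (x * y) in
  [/\ 0 < (x + y) / 2, 0 < s, s <= (x + y) / 2 &
      y <= x -> y <= s /\ (x + y) / 2 - s <= (x - y) / 2].
Proof.
move=> x0 y0 s; have s0 : 0 < s by rewrite sqrtr_gt0 mulr_gt0.
have sE : s * s = x * y by rewrite -expr2 sqr_sqrtr // mulr_ge0 // ltW.
split=> //; first lra.
  rewrite -(@ler_pXn2r _ 2) ?nnegrE //; try by apply/ltW; lra.
  by rewrite !expr2 sE; have := sqr_ge0 (x - y); rewrite expr2; lra.
move=> yx; have ys : y <= s.
  rewrite -(@ler_pXn2r _ 2) ?nnegrE //; try by apply/ltW; lra.
  by rewrite !expr2 sE ler_wpM2r // ltW.
by split=> //; lra.
Qed.

Lemma agm_cvg {R : realType} (a b : R) : 0 < a -> 0 < b ->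
  ((agm_seq a b j).1 @[j --> \oo] --> AGM a b) /\
  ((agm_seq a b j).2 @[j --> \oo] --> AGM a b).
Proof.
move=> a0 b0.
pose u j := (agm_seq a b j.+1).2; pose v j := (agm_seq a b j.+1).1.
have pos j : 0 < (agm_seq a b j).1 /\ 0 < (agm_seq a b j).2.
  elim: j => [//|j] /=; case: (agm_seq a b j) => x y /= [x0 y0].
  by case: (agm_step x0 y0).
have uv j : u j <= v j.
  rewrite /u /v /=; have := pos j; case: (agm_seq a b j) => x y /= [x0 y0].
  by case: (agm_step x0 y0).
have step j : [/\ u j <= u j.+1, v j.+1 <= v j &
                  v j.+1 - u j.+1 <= (v j - u j) / 2].
  have := pos j.+1; have := uv j; rewrite /u /v.
  rewrite -[agm_seq a b j.+2]/(let: (x, y) := agm_seq a b j.+1 in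
    ((x + y) / 2, Num.sqrt (x * y))).
  case: (agm_seq a b j.+1) => x y /= yx [x0 y0].
  have [_ _ _ /(_ yx)[ys dd]] := agm_step x0 y0.
  by split=> //; lra.
have u_nd : nondecreasing_seq u.
  by apply/nondecreasing_seqP => j; case: (step j).
have v_ni : nonincreasing_seq v.
  by apply/nonincreasing_seqP => j; case: (step j).
have d_le j : v j - u j <= (v 0%N - u 0%N) * 2^-1 ^+ j.
  elim: j => [|i IH]; first by rewrite expr0 mulr1.
  case: (step i) => _ _ /le_trans; apply.
  by rewrite exprSr mulrA ler_pM2r // invr_gt0.
have d0 : (v - u) @ \oo --> (0 : R).
  apply: (@squeeze_cvgr _ _ _ _ (cst 0) (geometric (v 0%N - u 0%N) 2^-1) (v - u)).
  - near=> j; apply/andP; split; first by rewrite /= subr_ge0.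
    exact: d_le.
  - exact: cvg_cst.
  - by apply: cvg_geometric; rewrite ger0_norm; lra.
have [luv cu cv] := adjacent_seq u_nd v_ni d0.
have cv1 : (agm_seq a b j).1 @[j --> \oo] --> limn v by rewrite -cvg_shiftS.
have -> : AGM a b = limn v by apply/cvg_lim.
by split=> //; rewrite -cvg_shiftS luv.
Unshelve. all: by end_near.
Qed.

(* Main.v *)
Require Import Defs.
From mathcomp Require Import measurable_realfun ring lra zify.
Import Order.TTheory GRing.Theory Num.Theory.
Import numFieldNormedType.Exports.

Set Implicit Arguments.
Unset Strict Implicit.
Unset Printing Implicit Defensive.

Local Open Scope classical_set_scope.
Local Open Scope ring_scope.

Local Notation mu := lebesgue_measure.

(** Write k = 1 / (4h) and m(n) for the integral of x^(2n) exp(- k x^4) over the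
    half line ([quartic_moment]). Expanding exp(x^2 / (2h)) into its power
    series, all of whose terms are nonnegative, gives the left-hand side as the
    sum over n of 2 m(n) / ((2h)^n n!) ([integral_moment_series]). The theorem
    therefore splits into two evaluations: the last factor of the right-hand
    side is 2 m(0) ([quartic_moment0_closed_form]), and the n-th term of C_1 is
    m(n) / ((2h)^n n! m(0)) ([C1_termE]).

    The value of m(0) comes from Gauss. In the double integral m(0)^2 the
    substitution y = x t / sqrt 2 makes the x-integral Gaussian in x^2 and
    leaves a multiple of the integral of 1 / sqrt(t^4 + 4)
    ([sqr_integral_quartic_weight]). The substitution u = (t - c / t) / 2
    ([integral_landen]) turns the latter into the elliptic integral
    [agm_integral] at (sqrt 2, 1). The same substitution with c = a b shows
    that [agm_integral] does not change under a step of the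
    arithmetic-geometric mean, so that [agm_integral a b] is squeezed to
    pi / (2 AGM(a, b)) ([integral_AGM]).

    The terms of C_1 need the ratios m(n) / m(0). Up to elementary factors m(n)
    is Gamma(n / 2 + 1 / 4), but two properties of the moments are enough:
    integration by parts, m(n + 2) = h (2n + 1) m(n) ([quartic_moment_rec]), and
    log-convexity, m(n + 1)^2 <= m(n) m(n + 2) ([quartic_moment_logconvex]).
    When n grows by 2, shifting the index of the first product by one shows that
    the radicand of C_1 is multiplied by ((2n + 1) / 4)^2, exactly as the
    recurrence predicts. This leaves n = 0, where the two infinite products are
    inverse to each other factor by factor, and n = 1, which amounts to the
    Wallis-type product
      prod_j (4j - 3) (4j + 1) / (4j - 1)^2 = m(1)^2 / (h m(0)^2).
    As in the classical proof of Wallis' formula, its partial products are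
    expressed by m(2N) / m(2N + 1) through the recurrence and squeezed by
    log-convexity ([cvg_wallis]). *)

(** * Primitives and improper integrals *)

Lemma is_derive_continuous (R : realType) (f : R -> R) (x df : R) :
  is_derive x 1 f df -> {for x, continuous f}.
Proof. by move=> h; apply/differentiable_continuous/derivable1_diffP. Qed.

Lemma integrable_itvcc (R : realType) (g : R -> R) (a b : R) :
  continuous g -> mu.-integrable `[a, b] (EFin \o g).
Proof.
move=> cg; apply: continuous_compact_integrable; first exact: segment_compact.
exact: continuous_subspaceT.
Qed.

(** The primitive is based at 0 and differentiated at positive points only;
    [cvg_primitive0] supplies the boundary value in improper integrals over
    the half line. *)
Lemma is_derive_primitive (R : realType) (g : R -> R) (x : R) : continuous g ->
  0 < x -> is_derive x 1 (fun y : R => \int[mu]_(t in `[0, y]) g t) (g x).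
Proof.
move=> cg x0.
have [dF Fx] : derivable (fun y : R => \int[mu]_(t in `[0, y]) g t) x 1 /\
    derive1 (fun y : R => \int[mu]_(t in `[0, y]) g t) x = g x.
  apply: (@continuous_FTC1_closed R g 0 x (x + 1)) => //.
    by rewrite ltrDl.
    exact: integrable_itvcc.
  exact: cg.
by apply: DeriveDef; [exact: dF|rewrite -derive1E].
Qed.

Lemma cvg_primitive0 (R : realType) (g : R -> R) : continuous g ->
  \int[mu]_(t in `[0, y]) g t @[y --> (0 : R)] --> (0 : R).
Proof.
move=> cg; apply: (@parameterized_integral_cvg_left R 0 1 g ltr01).
exact: integrable_itvcc.
Qed.

(** Substitutions such as t -> c / t, which sends infinity to 0, and
    x -> r x^2, whose derivative is unbounded, are carried out below by
    exhibiting an antiderivative: a primitive composed with the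
    substitution. *)
Lemma ge0_integral_FTC2y (R : realType) (f F : R -> R) (a l : R) :
    (forall x, a <= x -> 0 <= f x) ->
    (forall x, a <= x -> {for x, continuous f}) ->
    (forall x, a < x -> is_derive x 1 F (f x)) -> F x @[x --> a^'+] --> F a ->
    F x @[x --> +oo] --> l ->
  (\int[mu]_(x in `[a, +oo[) (f x)%:E = (l - F a)%:E)%E.
Proof.
move=> f0 cf dF Fa Fl; rewrite EFinB; apply: ge0_continuous_FTC2y => //.
- apply: continuous_in_subspaceT => x; rewrite inE/= in_itv/= andbT.
  exact: cf.
- by move=> x ax; have := dF _ ax => h.
- move=> x; rewrite in_itv/= andbT => ax.
  by rewrite derive1E; have := dF _ ax => h; rewrite derive_val.
Qed.

(** The improper integral is a limit along integers by monotone convergence;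
    monotonicity of the primitive extends it to the real variable. *)
Lemma cvgy_primitive (R : realType) (g : R -> R) (l : R) :
    continuous g -> (forall x, 0 <= g x) ->
    (\int[mu]_(t in `[0%R, +oo[) (g t)%:E = l%:E)%E ->
  \int[mu]_(t in `[0%R, x]) g t @[x --> +oo] --> l.
Proof.
move=> cg g0 gl.
have mg : measurable_fun [set: R] g by exact: continuous_measurable_fun.
have mgE D : measurable D -> measurable_fun D (fun x : R => (g x)%:E).
  by move=> mD; apply/measurable_EFinP; exact: measurable_funTS.
pose P (x : R) := \int[mu]_(t in `[0%R, x]) g t.
have PE x : (P x)%:E = (\int[mu]_(t in `[0%R, x]) (g t)%:E)%E.
  rewrite /P /Rintegral fineK//; apply: integrable_fin_num => //.
  exact: integrable_itvcc.
have Pl x : P x <= l.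
  rewrite -lee_fin PE -gl; apply: ge0_subset_integral => //=.
  - exact: mgE.
  - by move=> t _; rewrite lee_fin.
  - by move=> t; rewrite /= !in_itv/= andbT => /andP[].
have Pnd x y : x <= y -> P x <= P y.
  move=> xy; rewrite -lee_fin !PE; apply: ge0_subset_integral => //=.
  - exact: mgE.
  - by move=> t _; rewrite lee_fin.
  - by move=> t; rewrite /= !in_itv/= => /andP[-> /le_trans ->].
have Pn : P n%:R @[n --> \oo] --> l.
  apply: (@fine_cvg _ _ _ _ (fun n => \int[mu]_(t in `[0%R, n%:R]) (g t)%:E)%E).
  by rewrite -gl; exact: ge0_cvgn_integral.
apply/cvgrPdist_le => e e0.
have /cvgrPdist_le/(_ e e0)[N _ /(_ N (leqnn N))/= HN] := Pn.
near=> x; have Nx : N%:R <= x.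
  by near: x; apply: nbhs_pinfty_ge; rewrite num_real.
rewrite -/(P x) ger0_norm ?subr_ge0//; apply: le_trans HN.
by rewrite ger0_norm ?subr_ge0// lerD2l lerN2 Pnd.
Unshelve. all: end_near. Qed.

Lemma is_derive_inv (R : realType) (c t : R) : t != 0 ->
  is_derive t 1 (fun x => c / x) (- (c / t ^+ 2)).
Proof.
move=> t0; rewrite (_ : (fun x => _) = (cst c) * (fun x => x^-1))//.
have h := is_deriveV t0 (is_derive_id t 1).
by apply: is_derive_eq; rewrite scaler0 addr0 /GRing.scale/= mulr1 mulrN.
Qed.

Lemma cvgy_inv (R : realType) (c : R) : c / x @[x --> +oo] --> (0 : R).
Proof.
rewrite -[X in _ --> X](mulr0 c); apply: cvgM; first exact: cvg_cst.
apply/gtr0_cvgV0; last exact: cvg_id.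
by near=> x; near: x; exact: nbhs_pinfty_gt.
Unshelve. all: by end_near. Qed.

(** Change of variables t -> c / t: minus the primitive of [g] at [c / t] is an
    antiderivative of the right-hand integrand, and it vanishes at infinity. *)
Lemma integral_inversion (R : realType) (g : R -> R) (c s : R) :
    continuous g -> (forall x, 0 <= g x) -> 0 < c -> 0 < s ->
  (\int[mu]_(t in `[0%R, (c / s)%R]) (g t)%:E =
   \int[mu]_(t in `[s, +oo[) (g (c / t) * (c / t ^+ 2))%:E)%E.
Proof.
move=> cg g0 c0 s0.
pose P y := \int[mu]_(t in `[0, y]) g t.
have dP t : s <= t ->
    is_derive t 1 (fun t => - P (c / t)) (g (c / t) * (c / t ^+ 2)).
  move=> st; have t0 : 0 < t by exact: lt_le_trans st.
  have := is_derive_primitive cg (divr_gt0 c0 t0) => h.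
  have := is_derive_inv c (lt0r_neq0 t0) => h2.
  rewrite (_ : (fun _ => _) = - (P \o (fun t => c / t)))//.
  by apply: is_derive_eq; rewrite mulrN opprK.
rewrite (ge0_integral_FTC2y (l := 0) _ _ (fun t st => dP t (ltW st))).
- rewrite sub0r opprK /P /Rintegral fineK //.
  by apply: integrable_fin_num => //; exact: integrable_itvcc.
- move=> t st; rewrite mulr_ge0 // divr_ge0 ?exprn_ge0 // ltW //.
  exact: lt_le_trans st.
- move=> t st; have t0 : 0 < t by exact: lt_le_trans st.
  have ct := is_derive_continuous (is_derive_inv c (lt0r_neq0 t0)).
  apply: continuousM; first by apply: (continuous_comp ct); exact: cg.
  apply: continuousM; first exact: cst_continuous.
  apply: continuousV; first by rewrite expf_neq0// lt0r_neq0.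
  exact: exprn_continuous.
- apply: cvg_at_right_filter.
  exact: is_derive_continuous (dP s (lexx s)).
- rewrite -oppr0; apply: cvgN.
  apply: (@cvg_comp _ _ _ (fun t => c / t) P _ _ _ (cvgy_inv c)).
  exact: cvg_primitive0.
Qed.

(** The form g(t) dt is invariant under the involution t -> s^2 / t, which
    exchanges the two sides of its fixed point [s]. *)
Lemma integral_self_reciprocal (R : realType) (g : R -> R) (s : R) :
    continuous g -> (forall x, 0 <= g x) -> 0 < s ->
    (forall t, s <= t -> g (s ^+ 2 / t) * (s ^+ 2 / t ^+ 2) = g t) ->
  (\int[mu]_(t in `[0%R, +oo[) (g t)%:E =
   2%:E * \int[mu]_(t in `[s, +oo[) (g t)%:E)%E.
Proof.
move=> cg g0 s0 gs.
have mg : measurable_fun [set: R] g by exact: continuous_measurable_fun.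
rewrite (@itv_bndbnd_setU _ _ _ (BRight s)) ?bnd_simp//; last exact: ltW.
rewrite ge0_integral_setU//=.
- rewrite integral_itv_obnd_cbnd; last exact/measurable_EFinP/measurable_funTS.
  rewrite mule_natl mule2n; congr (_ + _)%E.
  rewrite [X in `[0, X]](_ : s = s ^+ 2 / s); last first.
    by rewrite expr2 mulfK// gt_eqF.
  rewrite integral_inversion ?exprn_gt0//.
  by apply: eq_integral => t; rewrite inE/= in_itv/= andbT => st; rewrite gs.
- exact/measurable_EFinP/measurable_funTS.
- by move=> x _; rewrite lee_fin.
- apply/disj_set2P; rewrite -subset0 => x/=.
  rewrite !in_itv/= => -[/andP[_ xs]].
  by rewrite andbT ltNge xs.
Qed.

(** * The arithmetic-geometric mean as an elliptic integral *)

Lemma continuous_invsqrt (R : realType) (p : R -> R) : continuous p ->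
  (forall t, 0 < p t) -> continuous (fun t => (Num.sqrt (p t))^-1).
Proof.
move=> cp p0 t; apply: (@continuousV _ _ (fun t => Num.sqrt (p t))).
  by rewrite gt_eqF// sqrtr_gt0.
by apply: (continuous_comp (cp t)); exact: sqrt_continuous.
Qed.

Lemma cvg_exprn (R : realType) (T : Type) (F : set_system T) (FF : Filter F)
    (f : T -> R) (n : nat) (l : R) :
  f @ F --> l -> f y ^+ n @[y --> F] --> l ^+ n.
Proof.
move=> fl; apply: (cvg_comp f (fun x => x ^+ n) fl); exact: exprn_continuous.
Qed.

Lemma continuous_exprnD (R : realType) (n : nat) (c : R) :
  continuous (fun t : R => t ^+ n + c).
Proof. by move=> t; apply: cvgD; [exact: exprn_continuous|exact: cvg_cst]. Qed.

Lemma landen_gt0 (R : realType) (c d t : R) : 0 < c -> 0 < d ->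
  0 < (t ^+ 2 - c) ^+ 2 + 4 * d * t ^+ 2.
Proof.
move=> c0 d0; have [->|t0] := eqVneq t 0.
  by rewrite expr0n/= mulr0 addr0 sub0r sqrrN exprn_gt0.
rewrite ltr_wpDl ?sqr_ge0//; apply: mulr_gt0; first by rewrite mulr_gt0.
by rewrite exprn_even_gt0.
Qed.

(** Substitute u = (t - c / t) / 2, for which
      u^2 + c = ((t + c / t) / 2)^2 and
      u^2 + d = ((t^2 - c)^2 + 4 d t^2) / (4 t^2).
    It maps the half line onto the whole line; by self-reciprocity of the
    left-hand integrand it is enough to use it from sqrt c on, where its
    derivative is bounded, and double. *)
Lemma integral_landen (R : realType) (c d : R) : 0 < c -> 0 < d ->
  (\int[mu]_(t in `[0%R, +oo[)
     ((Num.sqrt ((t ^+ 2 - c) ^+ 2 + 4 * d * t ^+ 2))^-1)%:E =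
   \int[mu]_(u in `[0%R, +oo[)
     ((Num.sqrt ((u ^+ 2 + c) * (u ^+ 2 + d)))^-1)%:E)%E.
Proof.
move=> c0 d0; pose s := Num.sqrt c.
have s0 : 0 < s by rewrite sqrtr_gt0.
have sE : s ^+ 2 = c by rewrite sqr_sqrtr// ltW.
pose Q (t : R) := (t ^+ 2 - c) ^+ 2 + 4 * d * t ^+ 2.
have Q0 (t : R) : 0 < Q t by exact: landen_gt0.
have cQ : continuous Q.
  move=> t; apply: cvgD; last first.
    by apply: cvgM; [exact: cvg_cst|exact: exprn_continuous].
  by apply: cvg_exprn; exact: continuous_exprnD.
rewrite (@integral_self_reciprocal _ _ s)//; last 2 first.
- exact: continuous_invsqrt.
- move=> t st; have t0 : 0 < t by exact: lt_le_trans st.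
  rewrite sE -/(Q _) -/(Q t).
  have -> : Q (c / t) = (c / t ^+ 2) ^+ 2 * Q t.
    by rewrite /Q; field; rewrite gt_eqF.
  have k0 : 0 < c / t ^+ 2 by rewrite divr_gt0 ?exprn_gt0.
  rewrite sqrtrM ?sqr_ge0// sqrtr_sqr gtr0_norm// invfM mulrAC mulVf ?mul1r//.
  by rewrite gt_eqF.
pose F t := (t - c / t) / 2.
pose G u := (Num.sqrt ((u ^+ 2 + c) * (u ^+ 2 + d)))^-1.
have Fs : F s = 0 by rewrite /F -sE expr2 mulfK ?subrr ?mul0r// gt_eqF.
have dF (t : R) : 0 < t -> is_derive t 1 F ((1 + c / t ^+ 2) / 2).
  move=> t0; have h := is_derive_inv c (lt0r_neq0 t0).
  rewrite (_ : F = (2^-1) \*: (id - (fun t => c / t))); last first.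
    by apply/funext => x; rewrite /F mulrC.
  by apply: is_derive_eq; rewrite opprK /GRing.scale/= mulrC.
have F' (t : R) : 0 < t -> derive1 F t = (1 + c / t ^+ 2) / 2.
  by move=> /dF h; rewrite derive1E derive_val.
have GF (t : R) : s <= t -> ((G \o F) * derive1 F) t = 2 * (Num.sqrt (Q t))^-1.
  move=> st; have t0 : 0 < t by exact: lt_le_trans st.
  rewrite -[LHS]/(G (F t) * derive1 F t) F'// /G.
  have tn0 : t != 0 by rewrite gt_eqF.
  have tc0 : 0 < t + c / t by rewrite addr_gt0 ?divr_gt0.
  have -> : (F t ^+ 2 + c) * (F t ^+ 2 + d) =
            ((t + c / t) / (4 * t)) ^+ 2 * Q t.
    by rewrite /F /Q; field.
  rewrite sqrtrM ?sqr_ge0// sqrtr_sqr gtr0_norm ?divr_gt0 ?mulr_gt0//.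
  have sQ0 : Num.sqrt (Q t) != 0 by rewrite gt_eqF// sqrtr_gt0.
  field; rewrite sQ0 tn0 /= gt_eqF//.
  by rewrite addr_gt0 ?mulr_gt0 ?exprn_gt0.
have cF (t : R) : 0 < t -> {for t, continuous F}.
  by move=> t0; exact: is_derive_continuous (dF _ t0).
have near_F' (T : set_system R) (l : R) : Filter T ->
    (\forall x \near T, 0 < x) -> (1 + c / x ^+ 2) / 2 @[x --> T] --> l ->
    derive1 F x @[x --> T] --> l.
  move=> FT T0; apply: cvg_trans; apply: near_eq_cvg.
  by near=> x; rewrite F'//; near: x.
have cF' (t : R) : 0 < t -> {for t, continuous (derive1 F)}.
  move=> t0; rewrite /prop_for /continuous_at F'//.
  apply: near_F'; first exact: lt_nbhsr.
  apply: cvgM; last exact: cvg_cst.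
  apply: cvgD; first exact: cvg_cst.
  apply: cvgM; first exact: cvg_cst.
  apply: cvgV; first by rewrite expf_neq0// gt_eqF.
  by apply: cvg_exprn; exact: cvg_id.
rewrite -Fs [RHS](@increasing_ge0_integration_by_substitutiony _ F G s).
- rewrite -ge0_integralZl_EFin//=.
  + by apply: eq_integral => t; rewrite inE/= in_itv/= andbT => st; rewrite GF.
  + apply/measurable_EFinP; apply: measurable_funTS.
    exact: continuous_measurable_fun (continuous_invsqrt cQ Q0).
- move=> x y /[!in_itv]/= /[!andbT] sx sy xy.
  have x0 := lt_le_trans s0 sx; have y0 := lt_le_trans s0 sy.
  rewrite /F ltr_pM2r// ltrB//.
  by rewrite ltr_pM2l// ltf_pV2.
- by move=> t; rewrite in_itv/= andbT => st; apply: cF'; exact: lt_trans st.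
- by apply/cvg_ex; exists (derive1 F s); apply: cvg_at_right_filter; exact: cF'.
- apply/cvg_ex; exists ((1 + 0 * 0) / 2); apply: near_F'.
    exact: nbhs_pinfty_gt.
  apply: cvgM; last exact: cvg_cst.
  apply: cvgD; first exact: cvg_cst.
  rewrite (_ : (fun x => c / x ^+ 2) = (fun x : R => (c / x) * (1 / x))).
    by apply: cvgM; exact: cvgy_inv.
  by apply/funext => x; rewrite mulrA mulr1 -mulrA -invfM -expr2.
- split=> [t|]; first rewrite in_itv/= andbT => st.
    by have [] := dF _ (lt_trans s0 st).
  by apply: cvg_at_right_filter; exact: cF.
- apply/cvgryPge => A; near=> x.
  have sx : s <= x by near: x; apply: nbhs_pinfty_ge; rewrite num_real.
  have Ax : 2 * A + s <= x by near: x; apply: nbhs_pinfty_ge; rewrite num_real.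
  have : c / x <= s.
    by rewrite ler_pdivrMr ?(lt_le_trans s0)// -sE expr2 ler_pM2l.
  rewrite /F; move: Ax; lra.
- apply: continuous_subspaceT; apply: continuous_invsqrt => [u|].
    by apply: cvgM; exact: continuous_exprnD.
  by move=> u; rewrite mulr_gt0// ltr_wpDl// sqr_ge0.
- by move=> x _; rewrite invr_ge0 sqrtr_ge0.
Unshelve. all: end_near. Qed.

(** With t = b tan(theta) this is Gauss' integral of
    1 / sqrt(a^2 cos^2(theta) + b^2 sin^2(theta)) over [0, pi / 2]. *)
Definition agm_integral (R : realType) (a b : R) : \bar R :=
  (\int[mu]_(t in `[0%R, +oo[)
     ((Num.sqrt ((t ^+ 2 + a ^+ 2) * (t ^+ 2 + b ^+ 2)))^-1)%:E)%E.

(** This is [integral_landen] for c = a b and d = ((a + b) / 2)^2, because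
    (t^2 - a b)^2 + (a + b)^2 t^2 = (t^2 + a^2) (t^2 + b^2). *)
Lemma agm_integral_step (R : realType) (a b : R) : 0 < a -> 0 < b ->
  agm_integral a b = agm_integral ((a + b) / 2) (Num.sqrt (a * b)).
Proof.
move=> a0 b0; have ab0 := mulr_gt0 a0 b0.
have d0 : 0 < ((a + b) / 2) ^+ 2 by rewrite exprn_gt0// divr_gt0 ?addr_gt0.
have := integral_landen ab0 d0; rewrite /agm_integral => h.
transitivity (\int[mu]_(t in `[0%R, +oo[)
  ((Num.sqrt ((t ^+ 2 - a * b) ^+ 2
     + 4 * ((a + b) / 2) ^+ 2 * t ^+ 2))^-1)%:E)%E.
  by apply: eq_integral => t _; congr (Num.sqrt _)^-1%:E; field.
rewrite h; apply: eq_integral => t _.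
by rewrite sqr_sqrtr ?ltW// [in LHS]mulrC.
Qed.

Lemma integral_cauchy (R : realType) (m : R) : 0 < m ->
  (\int[mu]_(t in `[0%R, +oo[) ((t ^+ 2 + m ^+ 2)^-1)%:E = (pi / (2 * m))%:E)%E.
Proof.
move=> m0; have mn0 : m != 0 by rewrite gt_eqF.
have p0 (t : R) : 0 < t ^+ 2 + m ^+ 2.
  by rewrite ltr_wpDl ?sqr_ge0 ?exprn_gt0.
have dF (t : R) :
    is_derive t 1 (fun x : R => m^-1 * atan (m^-1 * x)) (t ^+ 2 + m ^+ 2)^-1.
  rewrite (_ : (fun _ => _) = m^-1 \*: (@atan R \o (m^-1 \*: id)))//.
  apply: is_derive_eq; rewrite /GRing.scale/=.
  rewrite [X in (1 + X ^+ 2)](_ : _ = m^-1 * t)//.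
  field; rewrite mn0 gt_eqF//= addrC; exact: p0.
rewrite (ge0_integral_FTC2y (l := m^-1 * (pi / 2)) _ _ (fun t _ => dF t)).
- by rewrite mulr0 atan0 mulr0 subr0; congr _%:E; field.
- by move=> t _; rewrite invr_ge0 ltW.
- move=> t _; apply: continuousV; first by rewrite gt_eqF.
  apply: cvgD; last exact: cvg_cst.
  exact: exprn_continuous.
- by apply: cvg_at_right_filter; exact: is_derive_continuous (dF 0).
- apply: cvgM; first exact: cvg_cst.
  apply: (@cvg_comp _ _ _ (fun x => m^-1 * x) (@atan R) _ _ _ _ (@cvgy_atan R)).
  apply/cvgryPge => A; near=> x.
  rewrite mulrC ler_pdivlMr//; near: x; apply: nbhs_pinfty_ge; exact: num_real.
Unshelve. all: end_near. Qed.

Lemma continuous_agm_integrand (R : realType) (a b : R) : 0 < a -> 0 < b ->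
  continuous (fun t : R =>
    (Num.sqrt ((t ^+ 2 + a ^+ 2) * (t ^+ 2 + b ^+ 2)))^-1).
Proof.
move=> a0 b0; apply: continuous_invsqrt => [t|].
  by apply: cvgM; exact: continuous_exprnD.
by move=> t; rewrite mulr_gt0// ltr_wpDl ?sqr_ge0 ?exprn_gt0.
Qed.

Lemma agm_integral_le (R : realType) (a b c d : R) : 0 < a -> 0 < b ->
  a <= c -> b <= d -> (agm_integral c d <= agm_integral a b)%E.
Proof.
move=> a0 b0 ac bd; have c0 := lt_le_trans a0 ac; have d0 := lt_le_trans b0 bd.
apply: ge0_le_integral => //=.
- apply/measurable_EFinP; apply: measurable_funTS.
  exact: continuous_measurable_fun (continuous_agm_integrand c0 d0).
- apply/measurable_EFinP; apply: measurable_funTS.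
  exact: continuous_measurable_fun (continuous_agm_integrand a0 b0).
- move=> t _.
  have pos x y : 0 < x -> 0 < y -> 0 < (t ^+ 2 + x ^+ 2) * (t ^+ 2 + y ^+ 2).
    by move=> x0 y0; rewrite mulr_gt0// ltr_wpDl ?sqr_ge0 ?exprn_gt0.
  rewrite lee_fin lef_pV2 ?posrE ?sqrtr_gt0 ?pos// ler_wsqrtr//.
  apply: ler_pM; rewrite ?addr_ge0 ?sqr_ge0// lerD2l ler_pXn2r// nnegrE ltW//.
Qed.

Lemma agm_integral_diag (R : realType) (m : R) : 0 < m ->
  agm_integral m m = (pi / (2 * m))%:E.
Proof.
move=> m0; rewrite -integral_cauchy//; apply: eq_integral => t _.
by rewrite -expr2 sqrtr_sqr ger0_norm// addr_ge0 ?sqr_ge0.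
Qed.

Lemma agm_seq_ge (R : realType) (a b m : R) (j : nat) :
    0 < m -> m <= a -> m <= b ->
  m <= (agm_seq a b j).1 /\ m <= (agm_seq a b j).2.
Proof.
move=> m0 ma mb; elim: j => [//|j] /=; case: (agm_seq a b j) => x y /= [mx my].
split; first by rewrite ler_pdivlMr//; lra.
rewrite -[m](gtr0_norm m0) -sqrtr_sqr ler_wsqrtr// expr2.
by apply: ler_pM => //; exact: ltW.
Qed.

(** After j + 1 steps the unchanged integral lies, by monotonicity in each
    argument, between its values on the diagonal at the arithmetic and at the
    geometric iterate, and these two converge to the same limit. *)
Lemma integral_AGM (R : realType) (a b : R) : 0 < a -> 0 < b ->
  0 < AGM a b /\ agm_integral a b = (pi / (2 * AGM a b))%:E.
Proof.
move=> a0 b0; pose u j := agm_seq a b j.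
have [m [m0 ma mb]] : exists m, [/\ 0 < m, m <= a & m <= b].
  by exists (Num.min a b); rewrite lt_min a0 b0 !ge_min !lexx orbT.
have um j := agm_seq_ge j m0 ma mb.
have pos j : 0 < (u j).1 /\ 0 < (u j).2.
  by have [/(lt_le_trans m0) ? /(lt_le_trans m0) ?] := um j.
have [c1 c2] := agm_cvg a0 b0.
have M0 : 0 < AGM a b.
  apply: (lt_le_trans m0); apply: (cvgr_to_ge c1).
  by near=> j; have [] := um j.
split=> //.
have Iu j : agm_integral a b = agm_integral (u j).1 (u j).2.
  elim: j => [//|j ->]; have [p q] := pos j; rewrite agm_integral_step// /u /=.
  by case: (agm_seq a b j).
have ord j : (u j.+1).2 <= (u j.+1).1.
  have := pos j; rewrite /u /=; case: (agm_seq a b j) => x y /= [x0 y0].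
  by have [] := agm_step x0 y0.
have lo j : ((pi / (2 * (u j.+1).1))%:E <= agm_integral a b)%E.
  have [p q] := pos j.+1.
  by rewrite (Iu j.+1) -agm_integral_diag//; exact: agm_integral_le.
have hi j : (agm_integral a b <= (pi / (2 * (u j.+1).2))%:E)%E.
  have [p q] := pos j.+1.
  by rewrite (Iu j.+1) -agm_integral_diag//; exact: agm_integral_le.
have lim (v : nat -> R) : v @ \oo --> AGM a b ->
    pi / (2 * v j) @[j --> \oo] --> pi / (2 * AGM a b).
  move=> cv; apply: cvgM; first exact: cvg_cst.
  apply: cvgV; first by rewrite mulf_neq0// gt_eqF.
  by apply: cvgM => //; exact: cvg_cst.
have : agm_integral a b \is a fin_num.
  rewrite fin_numE; apply/andP; split.
    by rewrite gt_eqF// (lt_le_trans _ (lo 0%N))// ltNyr.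
  by rewrite lt_eqF// (le_lt_trans (hi 0%N))// ltry.
move: lo hi => + + /fineK rE; rewrite -rE; set r := fine _ => lo hi; congr _%:E.
apply/esym/(@cvg_unique _ _ (cst r @ \oo)) => //; last exact: cvg_cst.
apply: (@squeeze_cvgr _ _ _ _ (fun j => pi / (2 * (u j.+1).1))
                              (fun j => pi / (2 * (u j.+1).2))).
- by near=> j; have := lo j; have := hi j; rewrite !lee_fin => -> ->.
- apply: (lim (fun j => (u j.+1).1)).
  by rewrite (cvg_shiftS (fun j => (u j).1)).
- apply: (lim (fun j => (u j.+1).2)).
  by rewrite (cvg_shiftS (fun j => (u j).2)).
Unshelve. all: end_near. Qed.

(** * The square of the integral of exp(- k x^4) *)

Lemma cvgy_primitive_gauss (R : realType) :
  \int[mu]_(t in `[0%R, x]) gauss_fun t @[x --> +oo] --> (Num.sqrt pi / 2 : R).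
Proof.
apply: cvgy_primitive; first exact: continuous_gauss_fun.
  exact: gauss_fun_ge0.
exact: integral0y_gauss.
Qed.

(** The substitution y = sqrt K x^2 reduces this to the Gaussian integral. *)
Lemma integral_x_quartic (R : realType) (K : R) : 0 < K ->
  (\int[mu]_(x in `[0%R, +oo[) (x * expR (- (K * x ^+ 4)))%:E =
   (Num.sqrt pi / (4 * Num.sqrt K))%:E)%E.
Proof.
move=> K0; set r := Num.sqrt K; have r0 : 0 < r by rewrite sqrtr_gt0.
have rE : r ^+ 2 = K by rewrite sqr_sqrtr// ltW.
have rn0 : r != 0 by rewrite gt_eqF.
pose P (y : R) := \int[mu]_(t in `[0%R, y]) gauss_fun t.
pose F (x : R) := (2 * r)^-1 * P (r * x ^+ 2).
have dF (x : R) : 0 < x -> is_derive x 1 F (x * expR (- (K * x ^+ 4))).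
  move=> x0; have rx0 : 0 < r * x ^+ 2 by rewrite mulr_gt0 ?exprn_gt0.
  have h := is_derive_primitive (@continuous_gauss_fun R) rx0.
  have h2 : is_derive x 1 (fun x : R => r * x ^+ 2) (r * (2 * x)).
    rewrite (_ : (fun _ => _) = r \*: (id ^+ 2))//.
    by apply: is_derive_eq; rewrite /GRing.scale/= mulr1 expr1.
  rewrite (_ : F = (2 * r)^-1 \*: (P \o (fun x : R => r * x ^+ 2)))//.
  apply: is_derive_eq; rewrite /GRing.scale/= /gauss_fun exprMn rE -exprM.
  by field.
have F0 : F 0 = 0 by rewrite /F /P expr0n/= mulr0 set_itv1 Rintegral_set1 mulr0.
rewrite (ge0_integral_FTC2y (l := (2 * r)^-1 * (Num.sqrt pi / 2)) _ _ dF).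
- by rewrite F0 subr0; congr _%:E; field.
- by move=> x x0; rewrite mulr_ge0// expR_ge0.
- move=> x _; apply: cvgM; first exact: cvg_id.
  apply: (@continuous_comp _ _ _ (fun x : R => - (K * x ^+ 4)) expR).
    by apply: cvgN; apply: cvgM; [exact: cvg_cst|exact: exprn_continuous].
  exact: continuous_expR.
- apply: cvg_at_right_filter; rewrite F0 -[X in _ --> X](mulr0 (2 * r)^-1).
  apply: cvgM; first exact: cvg_cst.
  have c0 : r * x ^+ 2 @[x --> (0 : R)] --> (0 : R).
    rewrite -[X in _ --> X](_ : r * 0 ^+ 2 = 0); last by rewrite expr0n mulr0.
    by apply: cvgM; [exact: cvg_cst|exact: exprn_continuous].
  apply: (@cvg_comp _ _ _ (fun x : R => r * x ^+ 2) P _ _ _ c0).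
  by apply: cvg_primitive0; exact: continuous_gauss_fun.
- apply: cvgM; first exact: cvg_cst.
  have c0 : r * x ^+ 2 @[x --> +oo] --> (+oo : set_system R).
    apply/cvgryPge => A; near=> x.
    have x1 : 1 <= x by near: x; exact: nbhs_pinfty_ge.
    have xA : A / r <= x by near: x; apply: nbhs_pinfty_ge; rewrite num_real.
    rewrite mulrC -ler_pdivrMr//; apply: (le_trans xA).
    by rewrite expr2 ler_peMl// (le_trans _ x1).
  apply: (@cvg_comp _ _ _ (fun x : R => r * x ^+ 2) P _ _ _ c0).
  exact: cvgy_primitive_gauss.
Unshelve. all: end_near. Qed.

Lemma integral_scale (R : realType) (g : R -> R) (c : R) :
    continuous g -> (forall x, 0 <= g x) -> 0 < c ->
  (\int[mu]_(y in `[0%R, +oo[) (g y)%:E =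
   \int[mu]_(t in `[0%R, +oo[) (c * g (c * t))%:E)%E.
Proof.
move=> cg g0 c0.
have dF (t : R) : is_derive t 1 (fun t => c * t) c.
  rewrite (_ : (fun _ => _) = c \*: id)//.
  by apply: is_derive_eq; rewrite /GRing.scale/= mulr1.
have F' : derive1 (fun t => c * t) = cst c.
  by apply/funext => t; rewrite derive1E derive_val.
transitivity (\int[mu]_(y in `[((fun t => c * t) 0)%R, +oo[) (g y)%:E)%E.
  by rewrite mulr0.
rewrite (@increasing_ge0_integration_by_substitutiony _ (fun t => c * t) g 0).
- by apply: eq_integral => t _; rewrite F' /= [in RHS]mulrC.
- by move=> x y _ _ xy; rewrite ltr_pM2l.
- by rewrite F' => x _; exact: cst_continuous.
- by rewrite F'; exact: is_cvg_cst.
- by rewrite F'; exact: is_cvg_cst.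
- split=> [t _|]; first by have [] := dF t.
  by apply: cvg_at_right_filter; exact: is_derive_continuous (dF 0).
- apply/cvgryPge => A; near=> x.
  rewrite mulrC -ler_pdivrMr//; near: x; apply: nbhs_pinfty_ge; exact: num_real.
- exact: continuous_subspaceT.
- by move=> x _.
Unshelve. all: end_near. Qed.

(** Tonelli's theorem for the restrictions of the measures to [D] and [E],
    obtained by extending [g] by 0 outside of the rectangle. *)
Lemma tonelli_restrict (R : realType) (g : R * R -> R) (D E : set R) :
    measurable D -> measurable E -> measurable_fun [set: R * R] g ->
    (forall x y, D x -> E y -> 0 <= g (x, y)) ->
  (\int[mu]_(x in D) \int[mu]_(y in E) (g (x, y))%:E =
   \int[mu]_(y in E) \int[mu]_(x in D) (g (x, y))%:E)%E.
Proof.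
move=> mD mE mg g0.
pose f := (EFin \o g) \_ (D `*` E).
have mf : measurable_fun [set: R * R] f.
  apply/(measurable_restrictT _ _).1; first exact: measurableX.
  by apply/measurable_EFinP; exact: measurable_funTS.
have f0 z : (0 <= f z)%E.
  rewrite /f patchE; case: ifPn => //; rewrite inE => -[Dz Ez].
  by rewrite lee_fin; case: z Dz Ez => x y; exact: g0.
have := @fubini_tonelli _ _ _ _ _ mu mu f mf f0 => h.
rewrite integral_mkcond [RHS]integral_mkcond.
transitivity (\int[mu]_x \int[mu]_y f (x, y))%E.
  apply: eq_integral => x _; rewrite patchE; case: ifPn => [xD|xD].
    rewrite integral_mkcond; apply: eq_integral => y _.
    by rewrite /f !patchE in_setX/= xD.
  rewrite integral0_eq// => y _.
  by rewrite /f patchE in_setX/= (negbTE xD).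
rewrite h; apply: eq_integral => y _; rewrite patchE; case: ifPn => [yE|yE].
  rewrite [RHS]integral_mkcond; apply: eq_integral => x _.
  by rewrite /f !patchE in_setX/= yE andbT.
rewrite integral0_eq// => x _.
by rewrite /f patchE in_setX/= (negbTE yE) andbF.
Qed.

Definition quartic_weight (R : realType) (k x : R) : R := expR (- (k * x ^+ 4)).

Lemma continuous_quartic_weight (R : realType) (k : R) :
  continuous (quartic_weight k).
Proof.
move=> x; apply: (@continuous_comp _ _ _ (fun x : R => - (k * x ^+ 4)) expR).
  by apply: cvgN; apply: cvgM; [exact: cvg_cst|exact: exprn_continuous].
exact: continuous_expR.
Qed.

Lemma measurable_expR_quartic_weight (R : realType) (k l : R) (D : set R) :
  measurable D ->
  measurable_fun D (fun x : R => (expR (l * x ^+ 2) * quartic_weight k x)%:E).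
Proof.
move=> mD; apply/measurable_EFinP; apply: measurable_funTS.
apply: continuous_measurable_fun => x; apply: cvgM; last first.
  exact: continuous_quartic_weight.
apply: (@continuous_comp _ _ _ (fun x : R => l * x ^+ 2) expR).
  by apply: cvgM; [exact: cvg_cst|exact: exprn_continuous].
exact: continuous_expR.
Qed.

Lemma quartic_weight_ge0 (R : realType) (k x : R) : 0 <= quartic_weight k x.
Proof. exact: expR_ge0. Qed.

(** Since t^4 + 4 = (t^2 - 2)^2 + 4 t^2, this is the case c = 2, d = 1 of
    [integral_landen], whose right-hand side has sides sqrt 2 and 1. *)
Lemma integral_inv_sqrt_quartic (R : realType) :
  (\int[mu]_(t in `[0%R, +oo[) ((Num.sqrt (t ^+ 4 + 4))^-1)%:E =
   (pi / (2 * AGM (Num.sqrt 2) 1 : R))%:E)%E.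
Proof.
have s2 : 0 < Num.sqrt 2 :> R by rewrite sqrtr_gt0.
have [_ <-] := integral_AGM s2 (@ltr01 R).
transitivity (\int[mu]_(t in `[0%R, +oo[)
  ((Num.sqrt ((t ^+ 2 - 2) ^+ 2 + 4 * 1 * t ^+ 2))^-1 : R)%:E)%E.
  by apply: eq_integral => t _; congr (Num.sqrt _)^-1%:E; ring.
rewrite integral_landen//; apply: eq_integral => t _.
by rewrite sqr_sqrtr// expr1n.
Qed.

(** The factor 1 / sqrt 2 in y = x t / sqrt 2 is chosen so that
    x^4 + y^4 = (t^4 + 4) x^4 / 4, which leads to AGM(sqrt 2, 1) without
    rescaling the mean. *)
Lemma sqr_integral_quartic_weight (R : realType) (k : R) : 0 < k ->
  let m0 := (\int[mu]_(x in `[0%R, +oo[) (quartic_weight k x)%:E)%E in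
  (m0 * m0 =
   (pi * Num.sqrt pi /
      (4 * Num.sqrt 2 * Num.sqrt k * AGM (Num.sqrt 2) 1 : R))%:E)%E.
Proof.
move=> k0 m0; pose w := quartic_weight k.
have cw : continuous w := @continuous_quartic_weight R k.
have w0 : forall x, 0 <= w x := quartic_weight_ge0 k.
have mw : measurable_fun [set: R] w by exact: continuous_measurable_fun.
pose c : R := (Num.sqrt 2)^-1.
have c0 : 0 < c by rewrite invr_gt0 sqrtr_gt0.
have c4 : c ^+ 4 = 4^-1.
  by rewrite /c exprVn (exprM _ 2 2) sqr_sqrtr// -natrX.
have sk0 : 0 < Num.sqrt k by rewrite sqrtr_gt0.
pose g (z : R * R) : R :=
  c * z.1 * expR (- (k / 4 * (z.2 ^+ 4 + 4) * z.1 ^+ 4)).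
have m0_ge0 : (0 <= m0)%E by apply: integral_ge0 => x _; rewrite lee_fin.
have gE (x t : R) : g (x, t) = w x * (c * x * w (c * x * t)).
  rewrite mulrCA /w /quartic_weight -expRD /g/=; congr (_ * expR _).
  by rewrite !exprMn c4; field.
(* The point 0 is left out because the substitution y = c x t degenerates
   there. *)
transitivity (\int[mu]_(x in `]0%R, +oo[)
    \int[mu]_(t in `[0%R, +oo[) (g (x, t))%:E)%E.
  rewrite {2}/m0 -integral_itv_obnd_cbnd; last first.
    exact/measurable_EFinP/measurable_funTS.
  rewrite -ge0_integralZl//; last 2 first.
  - by apply/measurable_EFinP/measurable_funTS.
  - by move=> x _; rewrite lee_fin.
  apply: eq_integral => x; rewrite inE/= in_itv/= andbT => x0.
  have cx0 := mulr_gt0 c0 x0.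
  rewrite /m0 (integral_scale cw w0 cx0) muleC -ge0_integralZl_EFin//=.
  - by apply: eq_integral => t _; rewrite gE EFinM.
  - by move=> t _; rewrite lee_fin mulr_ge0// ltW.
  - apply/measurable_EFinP; apply: measurable_funTS.
    apply: continuous_measurable_fun => t.
    apply: cvgM; first exact: cvg_cst.
    apply: (@continuous_comp _ _ _ (fun t => c * x * t) w); last exact: cw.
    by apply: cvgM; [exact: cvg_cst|exact: cvg_id].
rewrite tonelli_restrict//; last 2 first.
- apply: measurable_funM.
    by apply: measurable_funM => //; exact: measurable_fst.
  apply: measurableT_comp => //; apply: measurableT_comp => //.
  apply: measurable_funM; last by apply: measurable_funX; exact: measurable_fst.
  apply: measurable_funM => //; apply: measurable_funD => //.
  by apply: measurable_funX; exact: measurable_snd.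
- move=> x y /=; rewrite in_itv/= andbT => x0 _.
  by rewrite gE mulr_ge0// mulr_ge0// mulr_ge0// ltW.
transitivity (\int[mu]_(t in `[0%R, +oo[)
    ((c * Num.sqrt pi / (2 * Num.sqrt k))%:E *
     ((Num.sqrt (t ^+ 4 + 4))^-1)%:E))%E.
  apply: eq_integral => t _.
  have t4 : 0 < t ^+ 4 + 4 by rewrite ltr_wpDl// exprn_even_ge0.
  have K0 : 0 < k / 4 * (t ^+ 4 + 4) by rewrite mulr_gt0 ?divr_gt0.
  pose K := k / 4 * (t ^+ 4 + 4).
  have mx : measurable_fun [set: R] (fun x : R => x * expR (- (K * x ^+ 4))).
    apply: measurable_funM => //; apply: measurableT_comp => //.
    by apply: measurableT_comp => //; apply: measurable_funM => //;
      exact: measurable_funX.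
  transitivity (\int[mu]_(x in `]0%R, +oo[)
      (c%:E * (x * expR (- (K * x ^+ 4)))%:E))%E.
    by apply: eq_integral => x _; rewrite -EFinM mulrA.
  rewrite integral_itv_obnd_cbnd; last first.
    by apply: measurable_funeM; exact/measurable_EFinP/measurable_funTS.
  rewrite ge0_integralZl_EFin//=; last 3 first.
  - move=> x; rewrite in_itv/= andbT => x0.
    by rewrite lee_fin mulr_ge0 ?expR_ge0.
  - exact/measurable_EFinP/measurable_funTS.
  - exact: ltW.
  rewrite integral_x_quartic// -!EFinM /K; congr _%:E.
  rewrite !sqrtrM ?divr_ge0 ?ltW// sqrtrV// (_ : Num.sqrt 4 = 2); last first.
    by rewrite (_ : 4 = 2 ^+ 2) ?sqrtr_sqr ?ger0_norm// -natrX.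
  by field; rewrite !gt_eqF// sqrtr_gt0.
rewrite ge0_integralZl_EFin//=; last 2 first.
- apply/measurable_EFinP; apply: measurable_funTS.
  apply: continuous_measurable_fun.
  apply: continuous_invsqrt; first exact: continuous_exprnD.
  by move=> t; rewrite ltr_wpDl// exprn_even_ge0.
- by rewrite divr_ge0 ?mulr_ge0 ?sqrtr_ge0 ?ltW.
rewrite integral_inv_sqrt_quartic -EFinM; congr _%:E.
have s2 : 0 < Num.sqrt 2 :> R by rewrite sqrtr_gt0.
have [A0 _] := integral_AGM s2 (@ltr01 R).
rewrite /c; field; rewrite !gt_eqF// sqrtr_gt0//.
Qed.

(** * Moments of exp(- k x^4) *)

Lemma expr_le_fact_expR (R : realType) (n : nat) (x : R) : 0 <= x ->
  x ^+ n <= n`!%:R * expR x.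
Proof.
move=> x0; rewrite -ler_pdivrMl ?ltr0n ?fact_gt0//.
case: n => [|n]; first by rewrite fact0 invr1 mul1r expr0 -expR0 ler_expR.
rewrite mulrC (le_trans _ (expR_ge1Dxn n x0))// ler_wpDl//.
Qed.

(** Moments are extended reals until they are known to be finite;
    [quartic_moment] below is the real value. *)
Definition quartic_emoment (R : realType) (k : R) (n : nat) : \bar R :=
  (\int[mu]_(x in `[0%R, +oo[) (x ^+ (2 * n) * quartic_weight k x)%:E)%E.

Lemma continuous_moment_integrand (R : realType) (k : R) (n : nat) :
  continuous (fun x : R => x ^+ n * quartic_weight k x).
Proof.
move=> x; apply: cvgM; first exact: exprn_continuous.
exact: continuous_quartic_weight.
Qed.

Lemma moment_integrand_ge0 (R : realType) (k x : R) (n : nat) :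
  0 <= x ^+ (2 * n) * quartic_weight k x.
Proof. by rewrite mulr_ge0 ?quartic_weight_ge0// exprM exprn_ge0// sqr_ge0. Qed.

Lemma measurable_moment_integrand (R : realType) (k : R) (n : nat)
    (D : set R) : measurable D ->
  measurable_fun D (fun x : R => (x ^+ n * quartic_weight k x)%:E).
Proof.
move=> mD; apply/measurable_EFinP; apply: measurable_funTS.
exact: continuous_measurable_fun (@continuous_moment_integrand R k n).
Qed.

Lemma quartic_emoment0_fin_num (R : realType) (k : R) : 0 < k ->
  quartic_emoment k 0 \is a fin_num.
Proof.
move=> k0; have := sqr_integral_quartic_weight k0 => /=.
rewrite (_ : (\int[_]_(_ in _) _)%E = quartic_emoment k 0); last first.
  by apply: eq_integral => x _; rewrite muln0 expr0 mul1r.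
have : (0 <= quartic_emoment k 0)%E.
  by apply: integral_ge0 => x _; rewrite lee_fin moment_integrand_ge0.
by case: (quartic_emoment k 0) => //= _; rewrite mulyy.
Qed.

(** Completing the square, l x^2 - k x^4 <= l^2 / (2k) - (k / 2) x^4. *)
Lemma quartic_integral_lty (R : realType) (k l : R) : 0 < k ->
  (\int[mu]_(x in `[0%R, +oo[)
     (expR (l * x ^+ 2) * quartic_weight k x)%:E < +oo)%E.
Proof.
move=> k0; have k20 : 0 < k / 2 by rewrite divr_gt0.
have := quartic_emoment0_fin_num k20.
have mom0 : (0 <= quartic_emoment (k / 2) 0)%E.
  by apply: integral_ge0 => x _; rewrite lee_fin moment_integrand_ge0.
move=> fin.
apply: (@le_lt_trans _ _
  ((expR (l ^+ 2 / (2 * k)))%:E * quartic_emoment (k / 2) 0)%E); last first.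
  by rewrite -(fineK fin) -EFinM ltry.
rewrite -ge0_integralZl_EFin//=; last 2 first.
- by move=> x _; rewrite lee_fin moment_integrand_ge0.
- exact: measurable_moment_integrand.
apply: ge0_le_integral => //=.
- by move=> x _; rewrite lee_fin mulr_ge0 ?expR_ge0.
- exact: measurable_expR_quartic_weight.
- by apply: measurable_funeM; exact: measurable_moment_integrand.
- move=> x _; rewrite -EFinM lee_fin muln0 expr0 mul1r /quartic_weight.
  rewrite -!expRD ler_expR -subr_ge0.
  have -> : l ^+ 2 / (2 * k) - k / 2 * x ^+ 4 - (l * x ^+ 2 - k * x ^+ 4) =
            (l - k * x ^+ 2) ^+ 2 / (2 * k) by field; rewrite gt_eqF.
  by rewrite divr_ge0 ?sqr_ge0// mulr_ge0// ltW.
Qed.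

Lemma quartic_emoment_fin_num (R : realType) (k : R) (n : nat) : 0 < k ->
  quartic_emoment k n \is a fin_num.
Proof.
move=> k0; have m0 : (0 <= quartic_emoment k n)%E.
  by apply: integral_ge0 => x _; rewrite lee_fin moment_integrand_ge0.
rewrite ge0_fin_numE//.
have mI := measurable_expR_quartic_weight k 1 (measurable_itv `[0%R, +oo[).
apply: (@le_lt_trans _ _ (n`!%:R%:E * \int[mu]_(x in `[0%R, +oo[)
  (expR (1 * x ^+ 2) * quartic_weight k x)%:E)%E); last first.
  have := quartic_integral_lty 1 k0.
  rewrite -ge0_fin_numE; first by move/fineK <-; rewrite -EFinM ltry.
  by apply: integral_ge0 => x _; rewrite lee_fin mulr_ge0 ?expR_ge0.
rewrite -ge0_integralZl_EFin//=; last first.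
  by move=> x _; rewrite lee_fin mulr_ge0 ?expR_ge0.
apply: ge0_le_integral => //=.
- by move=> x _; rewrite lee_fin moment_integrand_ge0.
- exact: measurable_moment_integrand.
- exact: measurable_funeM.
- move=> x _; rewrite -EFinM lee_fin mulrA ler_wpM2r ?expR_ge0// exprM mul1r.
  by apply: expr_le_fact_expR; exact: sqr_ge0.
Qed.

Definition quartic_moment (R : realType) (k : R) (n : nat) : R :=
  fine (quartic_emoment k n).

Lemma quartic_momentE (R : realType) (k : R) (n : nat) : 0 < k ->
  quartic_emoment k n = (quartic_moment k n)%:E.
Proof. by move=> k0; rewrite fineK// quartic_emoment_fin_num. Qed.

Lemma quartic_moment_ge0 (R : realType) (k : R) (n : nat) :
  0 <= quartic_moment k n.
Proof.
apply: fine_ge0; apply: integral_ge0 => x _.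
by rewrite lee_fin moment_integrand_ge0.
Qed.

Lemma quartic_moment0_sqr (R : realType) (k : R) : 0 < k ->
  quartic_moment k 0 ^+ 2 =
  pi * Num.sqrt pi / (4 * Num.sqrt 2 * Num.sqrt k * AGM (Num.sqrt 2) 1).
Proof.
move=> k0; have := sqr_integral_quartic_weight k0 => /=.
rewrite (_ : (\int[_]_(_ in _) _)%E = quartic_emoment k 0); last first.
  by apply: eq_integral => x _; rewrite muln0 expr0 mul1r.
by rewrite quartic_momentE// -EFinM -expr2 => -[].
Qed.

(** The boundary term of the integration by parts is O(1 / x), as
    exp(- k x^4) <= (n + 1)! / (k x^4)^(n + 1). *)
Lemma cvgy_moment_boundary (R : realType) (k : R) (n : nat) : 0 < k ->
  x ^+ (2 * n).+1 * quartic_weight k x @[x --> +oo] --> (0 : R).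
Proof.
move=> k0; pose C := n.+1`!%:R / k ^+ n.+1.
apply: (@squeeze_cvgr _ _ _ _ (cst 0) (fun x => C / x)); last 2 first.
- exact: cvg_cst.
- exact: cvgy_inv.
near=> x; have x1 : 1 <= x by near: x; exact: nbhs_pinfty_ge.
have x0 : 0 < x by exact: lt_le_trans x1.
have kx0 : 0 < k * x ^+ 4 by rewrite mulr_gt0 ?exprn_gt0.
apply/andP; split.
  by rewrite mulr_ge0 ?quartic_weight_ge0 ?exprn_ge0 ?ltW.
rewrite ler_pdivlMr// mulrAC -exprSr.
have := expr_le_fact_expR n.+1 (ltW kx0).
rewrite /quartic_weight expRN -ler_pdivrMr ?expR_gt0// exprMn -exprM => h.
rewrite /C ler_pdivlMr ?exprn_gt0//; apply: le_trans h.
rewrite mulrAC ler_wpM2r ?invr_ge0 ?expR_ge0//.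
rewrite mulrC; apply: ler_wpM2l; first by rewrite exprn_ge0// ltW.
by rewrite ler_weXn2l// !mulnS; lia.
Unshelve. all: end_near. Qed.

(** Integration by parts with only one improper integral, that of a nonnegative
    function: subtracting the boundary term from (2n + 1) times the primitive
    of the n-th integrand gives an antiderivative of 4k times the (n + 2)-th
    one. *)
Lemma quartic_moment_rec (R : realType) (k : R) (n : nat) : 0 < k ->
  4 * k * quartic_moment k n.+2 = (2 * n%:R + 1) * quartic_moment k n.
Proof.
move=> k0; pose g (x : R) := x ^+ (2 * n) * quartic_weight k x.
have cg : continuous g by exact: continuous_moment_integrand.
have g0 x : 0 <= g x by exact: moment_integrand_ge0.
pose P (x : R) := \int[mu]_(t in `[0%R, x]) g t.
pose B (x : R) := x ^+ (2 * n).+1 * quartic_weight k x.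
pose F (x : R) := (2 * n%:R + 1) * P x - B x.
have dB (x : R) : is_derive x 1 B
    ((2 * n%:R + 1) * g x - 4 * k * (x ^+ (2 * n.+2) * quartic_weight k x)).
  have dq : is_derive x 1 (fun x : R => - (k * x ^+ 4)) (- (4 * k * x ^+ 3)).
    rewrite (_ : (fun _ => _) = - (k \*: (id ^+ 4)))//.
    by apply: is_derive_eq; rewrite /GRing.scale/= mulr1 mulrCA mulrA.
  rewrite (_ : B = (id ^+ (2 * n).+1) *
      (expR \o (fun x : R => - (k * x ^+ 4)))); last by rewrite exprfctE.
  apply: is_derive_eq; rewrite /GRing.scale/= /g /quartic_weight mulr1.
  rewrite exprfctE (_ : (2 * n.+2)%N = ((2 * n) + 4)%N); last first.
    by rewrite !mulnS; lia.
  by rewrite exprS exprD -[(2 * n).+1%:R]natr1 natrM; ring.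
have dF (x : R) : 0 < x ->
    is_derive x 1 F (4 * k * (x ^+ (2 * n.+2) * quartic_weight k x)).
  move=> x0; have h := is_derive_primitive cg x0; have h2 := dB x.
  rewrite (_ : F = ((2 * n%:R + 1) \*: P) - B)//.
  by apply: is_derive_eq; rewrite /GRing.scale/=; ring.
have P0 : P 0 = 0 by rewrite /P set_itv1 Rintegral_set1.
have B0 : B 0 = 0 by rewrite /B expr0n/= mul0r.
have F0 : F 0 = 0 by rewrite /F P0 B0 mulr0 subrr.
have := @ge0_integral_FTC2y _ _ F 0
  ((2 * n%:R + 1) * quartic_moment k n - 0) _ _ dF _ _.
rewrite F0 !subr0 => H; apply: EFin_inj; rewrite -H.
- rewrite EFinM -quartic_momentE// -ge0_integralZl_EFin//=.
  + by move=> x _; rewrite lee_fin moment_integrand_ge0.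
  + exact: measurable_moment_integrand.
  + by rewrite mulr_ge0// ltW.
- by move=> x _; rewrite mulr_ge0 ?moment_integrand_ge0// mulr_ge0// ltW.
- move=> x _; apply: cvgM; first exact: cvg_cst.
  exact: continuous_moment_integrand.
- apply: cvg_at_right_filter; rewrite -[X in _ --> X]F0 /F P0 B0.
  apply: cvgB; first by apply: cvgM; [exact: cvg_cst|exact: cvg_primitive0].
  by rewrite -[X in _ --> X]B0; exact: is_derive_continuous (dB 0).
- rewrite -[X in _ --> X]subr0; apply: cvgB; last exact: cvgy_moment_boundary.
  apply: cvgM; first exact: cvg_cst.
  by apply: cvgy_primitive => //; exact: quartic_momentE.
Qed.

(** Integrate (a - b x^2)^2 >= 0 against x^(2n) exp(- k x^4). The minus sign is
    moved to the other side so that only nonnegative functions are integrated.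
    Keeping [a] and [b] free lets the inequality also serve to prove that the
    moments are positive. *)
Lemma quartic_moment_amgm (R : realType) (k a b : R) (n : nat) :
    0 < k -> 0 <= a -> 0 <= b ->
  2 * a * b * quartic_moment k n.+1 <=
  a ^+ 2 * quartic_moment k n + b ^+ 2 * quartic_moment k n.+2.
Proof.
move=> k0 a0 b0; rewrite -lee_fin EFinD (EFinM (2 * a * b)).
rewrite (EFinM (a ^+ 2)) (EFinM (b ^+ 2)) -!quartic_momentE//.
have mm j : measurable_fun (`[0, +oo[ : set R)
    (fun x : R => (x ^+ (2 * j) * quartic_weight k x)%:E).
  exact: measurable_moment_integrand.
have m0 j x : (0 <= (x ^+ (2 * j) * quartic_weight k x)%:E)%E.
  by rewrite lee_fin moment_integrand_ge0.
have ab0 : 0 <= 2 * a * b by rewrite mulr_ge0// mulr_ge0.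
rewrite -!ge0_integralZl_EFin//= ?sqr_ge0//; try exact: mm.
rewrite -ge0_integralD//=; last 4 first.
- by move=> x _; rewrite mule_ge0// lee_fin sqr_ge0.
- by apply: measurable_funeM; exact: mm.
- by move=> x _; rewrite mule_ge0// lee_fin sqr_ge0.
- by apply: measurable_funeM; exact: mm.
apply: ge0_le_integral => //=.
- by move=> x _; rewrite mule_ge0// lee_fin mulr_ge0// mulr_ge0.
- by apply: measurable_funeM; exact: mm.
- by apply: emeasurable_funD; apply: measurable_funeM; exact: mm.
- move=> x _; rewrite -!EFinM -EFinD lee_fin -subr_ge0 !mulnS.
  have -> : a ^+ 2 * (x ^+ (2 * n) * quartic_weight k x) +
   b ^+ 2 * (x ^+ (2 + (2 + 2 * n)) * quartic_weight k x) -
   2 * a * b * (x ^+ (2 + 2 * n) * quartic_weight k x) =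
   (a - b * x ^+ 2) ^+ 2 * (x ^+ (2 * n) * quartic_weight k x).
     by rewrite !exprD; ring.
  by rewrite mulr_ge0 ?sqr_ge0 ?moment_integrand_ge0.
Qed.

Lemma quartic_moment0_gt0 (R : realType) (k : R) :
  0 < k -> 0 < quartic_moment k 0.
Proof.
move=> k0; rewrite lt_def quartic_moment_ge0 andbT -sqrf_eq0.
rewrite quartic_moment0_sqr//.
have s2 : 0 < Num.sqrt 2 :> R by rewrite sqrtr_gt0.
have [A0 _] := integral_AGM s2 (@ltr01 R).
by rewrite gt_eqF// divr_gt0 ?mulr_gt0 ?pi_gt0 ?sqrtr_gt0 ?pi_gt0.
Qed.

Lemma quartic_moment_gt0 (R : realType) (k : R) (n : nat) :
  0 < k -> 0 < quartic_moment k n.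
Proof.
move=> k0; have k4 : 0 < 4 * k by rewrite mulr_gt0.
have step j : 0 < quartic_moment k j -> 0 < quartic_moment k j.+2.
  move=> mj; have j0 : 0 < 2 * j%:R + 1 :> R by rewrite ltr_wpDl// mulr_ge0.
  by rewrite -(pmulr_rgt0 _ k4) quartic_moment_rec// mulr_gt0.
(* If m(1) vanished, so would m(3), and with a = b = 1 also m(2). *)
have m1 : 0 < quartic_moment k 1.
  rewrite lt_def quartic_moment_ge0 andbT; apply/eqP => m1.
  have := quartic_moment_rec 1 k0; rewrite m1 mulr0 => /eqP.
  rewrite mulf_eq0 (gt_eqF k4)/= => /eqP m3.
  have := @quartic_moment_amgm _ k 1 1 1 k0 ler01 ler01.
  rewrite m1 m3; have := step 0%N (quartic_moment0_gt0 k0); lra.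
suff [] : 0 < quartic_moment k n /\ 0 < quartic_moment k n.+1 by [].
elim: n => [|n [h1 h2]]; first by split=> //; exact: quartic_moment0_gt0.
by split=> //; exact: step.
Qed.

(** Cauchy-Schwarz: take a = m(n + 1) and b = m(n) in [quartic_moment_amgm]. *)
Lemma quartic_moment_logconvex (R : realType) (k : R) (n : nat) : 0 < k ->
  quartic_moment k n.+1 ^+ 2 <= quartic_moment k n * quartic_moment k n.+2.
Proof.
move=> k0; have m0 := quartic_moment_gt0 n k0.
have := @quartic_moment_amgm _ k (quartic_moment k n.+1) (quartic_moment k n) n
  k0 (quartic_moment_ge0 _ _) (quartic_moment_ge0 _ _).
rewrite -subr_ge0 => h; rewrite -subr_ge0 -(pmulr_rge0 _ m0).
by apply: le_trans h _; rewrite le_eqVlt; apply/orP; left; apply/eqP; ring.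
Qed.

Lemma EFin_series_lim (R : realType) (u : nat -> R) : cvgn (series u) ->
  (\sum_(n <oo) (u n)%:E)%E = (limn (series u))%:E.
Proof.
move=> cu; rewrite -EFin_lim//; congr (limn _); apply/funext => n.
by rewrite /= /series/= sumEFin.
Qed.

(** All terms of the exponential series are nonnegative, so sum and integral
    can be exchanged without a domination argument. *)
Lemma integral_moment_series (R : realType) (k l : R) : 0 < k -> 0 <= l ->
  (\int[mu]_(x in `[0%R, +oo[)
     (expR (l * x ^+ 2) * quartic_weight k x)%:E =
   \sum_(n <oo) (l ^+ n / n`!%:R * quartic_moment k n)%:E)%E.
Proof.
move=> k0 l0.
have c0 n : 0 <= l ^+ n / n`!%:R by rewrite divr_ge0// exprn_ge0.
transitivity (\int[mu]_(x in `[0%R, +oo[) \sum_(n <oo)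
    (l ^+ n / n`!%:R)%:E * (x ^+ (2 * n) * quartic_weight k x)%:E)%E.
  apply: eq_integral => x _.
  transitivity (\sum_(n <oo)
      (quartic_weight k x)%:E * (exp_coeff (l * x ^+ 2) n)%:E)%E.
    rewrite nneseriesZl; last first.
      move=> n _; rewrite lee_fin /exp_coeff/= divr_ge0// exprn_ge0//.
      by rewrite mulr_ge0// sqr_ge0.
    rewrite EFin_series_lim; last exact: is_cvg_series_exp_coeff.
    by rewrite muleC.
  apply: eq_eseriesr => n _; rewrite -!EFinM /exp_coeff/=; congr _%:E.
  rewrite exprMn -exprM; ring.
rewrite integral_nneseries//=; last 2 first.
- by move=> n; apply: measurable_funeM; exact: measurable_moment_integrand.
- by move=> n x _; rewrite mule_ge0// lee_fin ?moment_integrand_ge0.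
apply: eq_eseriesr => n _.
rewrite (EFinM _ (quartic_moment k n)) -quartic_momentE//.
rewrite -ge0_integralZl_EFin//=.
- by move=> x _; rewrite lee_fin moment_integrand_ge0.
- exact: measurable_moment_integrand.
Qed.

(** * The infinite products *)

(** The quotient of the factors of the first product for n = 1 and n = 0. *)
Definition wallis_factor (R : realType) (j : nat) : R :=
  (4 * j%:R - 3) * (4 * j%:R + 1) / (4 * j%:R - 1) ^+ 2.

Lemma partial_prod0 (R : realType) (u : nat -> R) : partial_prod u 0 = 1.
Proof. by rewrite /partial_prod big_geq. Qed.

Lemma partial_prodS (R : realType) (u : nat -> R) (N : nat) :
  partial_prod u N.+1 = partial_prod u N * u N.+1.
Proof. by rewrite /partial_prod big_nat_recr. Qed.

Lemma eq_partial_prodM (R : realType) (u v w : nat -> R) :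
  (forall j, (0 < j)%N -> w j = u j * v j) ->
  forall N, partial_prod w N = partial_prod u N * partial_prod v N.
Proof.
move=> uvw; elim=> [|N IH]; first by rewrite !partial_prod0 mulr1.
by rewrite !partial_prodS IH uvw// mulrACA.
Qed.

Lemma partial_prod_gt0 (R : realType) (u : nat -> R) :
  (forall j, (0 < j)%N -> 0 < u j) -> forall N, 0 < partial_prod u N.
Proof.
move=> u0; elim=> [|N IH]; first by rewrite partial_prod0.
by rewrite partial_prodS mulr_gt0// u0.
Qed.

(** With r the expected value of the product, both sides are multiplied by
    (4N + 1) (4N + 5) / (4k)^2 when N grows by one, and they agree at N = 0. *)
Lemma wallis_moment (R : realType) (k : R) (N : nat) : 0 < k ->
  let r := 4 * k * quartic_moment k 1 ^+ 2 / quartic_moment k 0 ^+ 2 in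
  r * quartic_moment k (2 * N) ^+ 2 * (4 * N%:R + 1) =
  partial_prod (@wallis_factor R) N * (4 * k) *
    quartic_moment k (2 * N).+1 ^+ 2.
Proof.
move=> k0 r; have kn0 : k != 0 by rewrite gt_eqF.
elim: N => [|N IH].
  rewrite partial_prod0 muln0 mulr0 add0r mulr1 mul1r /r divfK//.
  by rewrite sqrf_eq0 gt_eqF// quartic_moment_gt0.
have rec j : quartic_moment k j.+2 =
    (2 * j%:R + 1) / (4 * k) * quartic_moment k j.
  by rewrite mulrAC -quartic_moment_rec//; field.
rewrite mulnS !rec partial_prodS /wallis_factor.
rewrite -[N.+1%:R]natr1 -[(2 * N).+1%:R]natr1 natrM.
have a0 : 4 * (N%:R + 1) - 1 != 0 :> R by have := ler0n R N; lra.
transitivity (r * quartic_moment k (2 * N) ^+ 2 * (4 * N%:R + 1) *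
   ((4 * N%:R + 1) * (4 * N%:R + 5) / (4 * k) ^+ 2)).
  by field; rewrite kn0.
by rewrite IH; field; rewrite kn0.
Qed.

(** Log-convexity at 2N and 2N + 1 bounds the quotient m(2N + 1) / m(2N) in
    [wallis_moment] from both sides, so that
    r <= W(N) <= r (4N + 3) / (4N + 1) for the partial products W(N). *)
Lemma cvg_wallis (R : realType) (k : R) : 0 < k ->
  partial_prod (@wallis_factor R) @ \oo -->
    4 * k * quartic_moment k 1 ^+ 2 / quartic_moment k 0 ^+ 2.
Proof.
move=> k0; set r := (X in _ --> X).
have r0 : 0 < r by rewrite divr_gt0 ?mulr_gt0 ?exprn_gt0 ?quartic_moment_gt0.
pose W := partial_prod (@wallis_factor R).
have k40 : 0 < 4 * k by rewrite mulr_gt0.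
have N0 N : 0 < 4 * N%:R + 1 :> R by rewrite ltr_wpDl// mulr_ge0.
have W0 N : 0 < W N.
  apply: partial_prod_gt0 => j j0; have : 1 <= j%:R :> R by rewrite ler1n.
  by move=> j1; rewrite /wallis_factor divr_gt0 ?mulr_gt0 ?exprn_gt0//; lra.
have inv N : r * quartic_moment k (2 * N) ^+ 2 * (4 * N%:R + 1) =
    W N * (4 * k) * quartic_moment k (2 * N).+1 ^+ 2 by exact: wallis_moment.
have rec j : quartic_moment k j.+2 =
    (2 * j%:R + 1) / (4 * k) * quartic_moment k j.
  by rewrite mulrAC -quartic_moment_rec//; field; rewrite gt_eqF.
have lo N : r <= W N.
  have m0 : 0 < quartic_moment k (2 * N) ^+ 2 * (4 * N%:R + 1).
    by rewrite mulr_gt0 ?exprn_gt0 ?quartic_moment_gt0.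
  rewrite -(ler_pM2r m0) [r * _]mulrA inv -mulrA ler_pM2l//.
  have := quartic_moment_logconvex (2 * N) k0; rewrite rec natrM => h.
  rewrite -ler_pdivlMl//; apply: le_trans h _.
  by rewrite le_eqVlt; apply/orP; left; apply/eqP; field; rewrite gt_eqF.
have hi N : W N <= r + 2 * r * harmonic N.
  suff h : W N * (4 * N%:R + 1) <= r * (4 * N%:R + 3).
    have : W N <= r + 2 * r / (4 * N%:R + 1).
      have -> : r + 2 * r / (4 * N%:R + 1) =
                r * (4 * N%:R + 3) / (4 * N%:R + 1).
        by field; rewrite gt_eqF.
      by rewrite ler_pdivlMr.
    move/le_trans; apply; rewrite lerD2l ler_pM2l; last exact: mulr_gt0.
    rewrite /harmonic/= lef_pV2 ?posrE// -[N.+1%:R]natr1 lerD2r.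
    by rewrite ler_peMl// ler1n.
  have m0 : 0 < quartic_moment k (2 * N) ^+ 2 * (4 * N%:R + 1).
    by rewrite mulr_gt0 ?exprn_gt0 ?quartic_moment_gt0.
  rewrite -(ler_pM2r m0).
  have -> : r * (4 * N%:R + 3) *
        (quartic_moment k (2 * N) ^+ 2 * (4 * N%:R + 1)) =
      W N * ((4 * k) ^+ 2 * (quartic_moment k (2 * N).+1 *
        ((4 * N%:R + 3) / (4 * k) * quartic_moment k (2 * N).+1))).
    transitivity (r * quartic_moment k (2 * N) ^+ 2 * (4 * N%:R + 1) *
                  (4 * N%:R + 3)); first by ring.
    by rewrite inv; field; rewrite gt_eqF.
  rewrite -[W N * _ * _]mulrA ler_pM2l//.
  have := quartic_moment_logconvex (2 * N).+1 k0.
  rewrite !rec -[(2 * N).+1%:R]natr1 natrM => h.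
  rewrite -(ler_pM2l (exprn_gt0 2 k40)) in h.
  have e : (4 * k) ^+ 2 *
      ((2 * (2 * N%:R) + 1) / (4 * k) * quartic_moment k (2 * N)) ^+ 2 =
    (4 * N%:R + 1) * (quartic_moment k (2 * N) ^+ 2 * (4 * N%:R + 1)).
    by field; rewrite gt_eqF.
  move: h; rewrite e => /le_trans; apply.
  by rewrite le_eqVlt; apply/orP; left; apply/eqP; field; rewrite gt_eqF.
apply: (@squeeze_cvgr _ _ _ _ (cst r) (fun N => r + 2 * r * harmonic N)).
- by near=> N; rewrite lo hi.
- exact: cvg_cst.
- rewrite -[X in _ --> X]addr0 -[X in _ --> _ + X](mulr0 (2 * r)).
  apply: cvgD; first exact: cvg_cst.
  by apply: cvgM; [exact: cvg_cst|exact: cvg_harmonic].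
Unshelve. all: end_near. Qed.

Lemma prodk1_cvg (R : realType) : cvgn (partial_prod (@prodk_factor R 1)).
Proof.
have f0 j : (0 < j)%N -> 0 < @prodk_factor R 1 j <= 1.
  move=> j0; have j1 : 1 <= j%:R :> R by rewrite ler1n.
  have d0 : 0 < j%:R * (2 * 1%:R + 4 * j%:R - 3) :> R.
    by rewrite mulr_gt0//; lra.
  rewrite /prodk_factor divr_gt0//=; last by rewrite mulr_gt0//; lra.
  by rewrite ler_pdivrMr// mul1r; nra.
have P0 := partial_prod_gt0 (fun j j0 => (andP (f0 j j0)).1).
apply: nonincreasing_is_cvgn.
  apply/nonincreasing_seqP => N; rewrite partial_prodS ger_pMr//.
  by have /andP[] := f0 N.+1 isT.
by exists 0 => _ [N _ <-]; exact: ltW.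
Qed.

Lemma prodk0_ge1 (R : realType) (N : nat) :
  1 <= partial_prod (@prodk_factor R 0) N.
Proof.
elim: N => [|N IH]; first by rewrite partial_prod0.
rewrite partial_prodS (le_trans IH)// ler_peMr ?(le_trans _ IH)//.
have j1 := ler0n R N.
rewrite /prodk_factor -[N.+1%:R]natr1 ler_pdivlMr; last first.
  by rewrite mulr_gt0//; lra.
nra.
Qed.

(** For n = 1 the partial products decrease; dividing by the Wallis product,
    whose limit is not zero, transfers convergence to n = 0. The second product
    of C_1 is the inverse of the first one for n = 0, factor by factor; it
    converges because the limit [L] of the latter is at least 1. *)
Lemma prodk_cvg (R : realType) (k : R) : 0 < k -> exists L : R,
  [/\ 0 < L, partial_prod (@prodk_factor R 0) @ \oo --> L,
      partial_prod (@prodl_factor R) @ \oo --> L^-1 &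
      partial_prod (@prodk_factor R 1) @ \oo -->
        L * (4 * k * quartic_moment k 1 ^+ 2 / quartic_moment k 0 ^+ 2)].
Proof.
move=> k0; set r := (4 * k * _ / _).
have r0 : 0 < r by rewrite divr_gt0 ?mulr_gt0 ?exprn_gt0 ?quartic_moment_gt0.
have Wr : partial_prod (@wallis_factor R) @ \oo --> r by exact: cvg_wallis.
have /cvg_ex[L1 L1E] := @prodk1_cvg R.
have pos j : (0 < j)%N -> 1 <= j%:R :> R by rewrite ler1n.
have W0 N : partial_prod (@wallis_factor R) N != 0.
  rewrite gt_eqF//; apply: partial_prod_gt0 => j j0; have := pos j j0.
  by move=> j1; rewrite /wallis_factor divr_gt0 ?mulr_gt0 ?exprn_gt0//; lra.
have e1 N : partial_prod (@prodk_factor R 1) N =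
    partial_prod (@prodk_factor R 0) N * partial_prod (@wallis_factor R) N.
  apply: eq_partial_prodM => j /pos j1; rewrite /prodk_factor /wallis_factor.
  by field; do ?[apply/andP; split]; lra.
have e2 N : 1 =
    partial_prod (@prodk_factor R 0) N * partial_prod (@prodl_factor R) N.
  rewrite -(@eq_partial_prodM _ _ _ (fun=> 1)) => [|j /pos j1].
    by rewrite /partial_prod big1.
  rewrite /prodk_factor /prodl_factor.
  by field; do ?[apply/andP; split]; lra.
have P0 : partial_prod (@prodk_factor R 0) @ \oo --> L1 / r.
  rewrite (_ : partial_prod _ = (fun N => partial_prod (@prodk_factor R 1) N /
     partial_prod (@wallis_factor R) N)); last first.
    by apply/funext => N; rewrite e1 mulfK.
  by apply: cvgM => //; apply: cvgV => //; rewrite gt_eqF.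
have L0 : 0 < L1 / r.
  apply: (lt_le_trans ltr01); apply: (cvgr_to_ge P0).
  by near=> N; exact: prodk0_ge1.
exists (L1 / r); split=> //; last by rewrite divfK// gt_eqF.
have p0 N : partial_prod (@prodk_factor R 0) N != 0.
  by rewrite gt_eqF// (lt_le_trans ltr01)// prodk0_ge1.
rewrite (_ : partial_prod _ =
    (fun N => (partial_prod (@prodk_factor R 0) N)^-1)).
  by apply: cvgV => //; rewrite gt_eqF.
by apply/funext => N; rewrite -[RHS]mul1r (e2 N) mulrAC mulfV// mul1r.
Unshelve. all: end_near. Qed.

(** The factor at k for n + 2 is, up to its part independent of n, the factor
    at k + 1 for n, so the two partial products differ by end factors. *)
Lemma prodkSS_cvg (R : realType) (n : nat) (L : R) :
  partial_prod (@prodk_factor R n) @ \oo --> L ->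
  partial_prod (@prodk_factor R n.+2) @ \oo -->
    L * ((2 * n%:R + 1) / (2 * n%:R + 3)).
Proof.
move=> PL; have n0 := ler0n R n.
have e N : partial_prod (@prodk_factor R n.+2) N =
    partial_prod (@prodk_factor R n) N *
    ((2 * n%:R + 1) / (2 * n%:R + 3) * (1 + 2 / (2 * n%:R + 4 * N%:R + 1))).
  elim: N => [|N IH].
    rewrite !partial_prod0 mulr0 addr0; field; apply/andP; split; lra.
  have N0 := ler0n R N.
  rewrite !partial_prodS IH /prodk_factor.
  rewrite -[n.+2%:R]natr1 -[n.+1%:R]natr1 -[N.+1%:R]natr1.
  by field; do ?[apply/andP; split]; lra.
rewrite (_ : partial_prod _ = (fun N => partial_prod (@prodk_factor R n) N *
    ((2 * n%:R + 1) / (2 * n%:R + 3) *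
     (1 + 2 / (2 * n%:R + 4 * N%:R + 1))))); last exact/funext.
apply: cvgM => //; rewrite -[X in _ --> X]mulr1.
apply: cvgM; first exact: cvg_cst.
rewrite -[X in _ --> X]addr0; apply: cvgD; first exact: cvg_cst.
apply: (@squeeze_cvgr _ _ _ _ (cst 0) (fun N => 2 * harmonic N)).
- near=> N; have N0 := ler0n R N.
  have d0 : 0 < 2 * n%:R + 4 * N%:R + 1 :> R by lra.
  rewrite divr_ge0 ?(ltW d0)//= ler_pM2l// lef_pV2 ?posrE ?ltr0n//.
  by rewrite -[N.+1%:R]natr1; lra.
- exact: cvg_cst.
- rewrite -[X in _ --> X](mulr0 2).
  by apply: cvgM; [exact: cvg_cst|exact: cvg_harmonic].
Unshelve. all: end_near. Qed.

(** Both sides are (Gamma(n / 2 + 1 / 4) / Gamma(1 / 4))^2. The proof is an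
    induction by steps of 2, which multiply both sides by ((2n + 1) / 4)^2. *)
Lemma radicand_limit (R : realType) (k L0 : R) (n : nat) : 0 < k -> 0 < L0 ->
    partial_prod (@prodk_factor R 0) @ \oo --> L0 ->
    partial_prod (@prodk_factor R 1) @ \oo -->
        L0 * (4 * k * quartic_moment k 1 ^+ 2 / quartic_moment k 0 ^+ 2) ->
  exists L : R, partial_prod (@prodk_factor R n) @ \oo --> L /\
    (2 * n)%N`!%:R / (2 ^+ (3 * n)%N * n`!%:R) * L * L0^-1 =
    (quartic_moment k n / quartic_moment k 0) ^+ 2 * k ^+ n.
Proof.
move=> k0 L00 P0 P1.
have m0 : quartic_moment k 0 != 0 by rewrite gt_eqF// quartic_moment_gt0.
have kn0 : k != 0 by rewrite gt_eqF.
have Ln0 : L0 != 0 by rewrite gt_eqF.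
pose Q n := exists L : R, partial_prod (@prodk_factor R n) @ \oo --> L /\
    (2 * n)%N`!%:R / (2 ^+ (3 * n)%N * n`!%:R) * L * L0^-1 =
    (quartic_moment k n / quartic_moment k 0) ^+ 2 * k ^+ n.
suff [] : Q n /\ Q n.+1 by [].
elim: n => [|n [[L [PL LE]] Qn1]].
  split.
    exists L0; split=> //; rewrite !muln0 fact0 !expr0.
    by field; rewrite Ln0 m0.
  exists (L0 * (4 * k * quartic_moment k 1 ^+ 2 / quartic_moment k 0 ^+ 2)).
  split=> //.
  rewrite !muln1 expr1 (_ : 2`! = 2)%N// (_ : 1`! = 1)%N//.
  by field; rewrite Ln0 m0.
split=> //; exists (L * ((2 * n%:R + 1) / (2 * n%:R + 3))); split.
  exact: prodkSS_cvg.
have n0 := ler0n R n.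
have rec : quartic_moment k n.+2 =
    (2 * n%:R + 1) / (4 * k) * quartic_moment k n.
  by rewrite mulrAC -quartic_moment_rec//; field.
have -> : (quartic_moment k n.+2 / quartic_moment k 0) ^+ 2 * k ^+ n.+2 =
    (2 * n%:R + 1) ^+ 2 / 16 *
      ((quartic_moment k n / quartic_moment k 0) ^+ 2 * k ^+ n).
  by rewrite rec !exprS; field; rewrite kn0 m0.
rewrite -LE.
have f0 : n`!%:R != 0 :> R by rewrite pnatr_eq0 -lt0n fact_gt0.
have p0 : 2 ^+ (3 * n) != 0 :> R by rewrite expf_neq0// pnatr_eq0.
rewrite (_ : (2 * n.+2 = (2 * n).+4)%N); last by lia.
rewrite (_ : (3 * n.+2 = 3 * n + 6)%N); last by lia.
rewrite !factS !natrM exprD.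
rewrite -[(2 * n).+4%:R]natr1 -[(2 * n).+3%:R]natr1.
rewrite -[(2 * n).+2%:R]natr1 -[(2 * n).+1%:R]natr1.
rewrite -[n.+2%:R]natr1 -[n.+1%:R]natr1 natrM.
by field; rewrite f0 p0 Ln0 /=; do ?[apply/andP; split]; lra.
Qed.

(** * Assembling the formula *)

Lemma sqrtr_exprn (R : realType) (x : R) (n : nat) : 0 <= x ->
  Num.sqrt (x ^+ n) = Num.sqrt x ^+ n.
Proof.
move=> x0; elim: n => [|n IH]; first by rewrite !expr0 sqrtr1.
by rewrite !exprS sqrtrM// IH.
Qed.

Lemma sqrt_quarter_inv (R : realType) (h : R) : 0 < h ->
  Num.sqrt (1 / (4 * h)) = (2 * Num.sqrt h)^-1.
Proof.
move=> h0; rewrite mul1r sqrtrV ?mulr_ge0 ?(ltW h0)// sqrtrM//.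
rewrite (_ : 4 = 2 ^+ 2); last by rewrite -natrX.
by rewrite sqrtr_sqr ger0_norm.
Qed.

Lemma quartic_moment0_closed_form (R : realType) (h : R) : 0 < h ->
  Num.sqrt (h `^ (1 / 2) * 2 `^ (1 / 2) * pi `^ (3 / 2)) /
    (AGM (Num.sqrt 2) 1) `^ (1 / 2) = 2 * quartic_moment (1 / (4 * h)) 0.
Proof.
move=> h0; have k0 : 0 < 1 / (4 * h) by rewrite divr_gt0 ?mulr_gt0.
have s2 : 0 < Num.sqrt 2 :> R by rewrite sqrtr_gt0.
have sh : 0 < Num.sqrt h by rewrite sqrtr_gt0.
have [A0 _] := integral_AGM s2 (@ltr01 R).
set A := AGM _ _ in A0 *.
have pi0 : 0 < pi :> R by exact: pi_gt0.
rewrite !div1r !powR12_sqrt ?(ltW h0) ?(ltW A0)//.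
have -> : pi `^ (3 / 2) = pi * Num.sqrt pi :> R.
  rewrite (_ : 3 / 2 = 1 + 2^-1); last by field.
  by rewrite powRD ?powRr1 ?powR12_sqrt ?(ltW pi0)// (gt_eqF pi0) implybT.
rewrite -sqrtrV ?(ltW A0)// -sqrtrM; last first.
  by rewrite !mulr_ge0 ?sqrtr_ge0 ?(ltW pi0).
rewrite -[RHS]ger0_norm ?mulr_ge0 ?quartic_moment_ge0// -sqrtr_sqr.
congr Num.sqrt.
rewrite exprMn -[(4 * h)^-1]div1r quartic_moment0_sqr// sqrt_quarter_inv// -/A.
have s22 : Num.sqrt 2 * Num.sqrt 2 = 2 :> R by rewrite -expr2 sqr_sqrtr.
transitivity
  (Num.sqrt h * pi * Num.sqrt pi / A * (Num.sqrt 2 * Num.sqrt 2) / Num.sqrt 2).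
  by field; rewrite !gt_eqF.
by rewrite s22; field; rewrite !gt_eqF.
Qed.

Lemma C1_termE (R : realType) (h : R) (n : nat) : 0 < h ->
  let k := 1 / (4 * h) in
  C1_term h n =
    (1 / (2 * h)) ^+ n / n`!%:R * quartic_moment k n / quartic_moment k 0.
Proof.
move=> h0 k; have k0 : 0 < k by rewrite divr_gt0 ?mulr_gt0.
have m0 : 0 < quartic_moment k 0 by rewrite quartic_moment_gt0.
have [L0 [L00 P0 Q0 P1]] := prodk_cvg k0.
have [L [PL LE]] := radicand_limit n k0 L00 P0 P1.
rewrite /C1_term /infprod (cvg_lim _ PL)// (cvg_lim _ Q0)// LE.
rewrite sqrtrM ?sqr_ge0// sqrtr_sqr ger0_norm ?divr_ge0 ?quartic_moment_ge0//.
rewrite sqrtr_exprn ?(ltW k0)//.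
have -> : h `^ (n%:R / 2) = Num.sqrt h ^+ n.
  by rewrite mulrC powRrM powR12_sqrt ?(ltW h0)// powR_mulrn ?sqrtr_ge0.
have sh0 : 0 < Num.sqrt h by rewrite sqrtr_gt0.
have e : (1 / (2 * h)) = Num.sqrt k / Num.sqrt h.
  rewrite sqrt_quarter_inv// -{1}(sqr_sqrtr (ltW h0)).
  by field; rewrite gt_eqF.
have f0 : n`!%:R != 0 :> R by rewrite pnatr_eq0 -lt0n fact_gt0.
rewrite e exprMn exprVn; field.
by rewrite f0 expf_neq0 ?gt_eqF.
Qed.

Lemma ge0_cvg_series (R : realType) (u : nat -> R) (S : R) :
    (forall n, 0 <= u n) -> (\sum_(n <oo) (u n)%:E = S%:E)%E ->
  series u @ \oo --> S.
Proof.
move=> u0 uS; have cu : cvgn (series u).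
  apply: nondecreasing_is_cvgn.
    by apply/nondecreasing_seqP => n; rewrite seriesSr lerDl.
  exists S => _ [n _ <-]; rewrite -lee_fin -uS /series/= -sumEFin.
  by apply: nneseries_lim_ge => i _ _; rewrite lee_fin.
have := EFin_series_lim cu; rewrite uS => -[->]; exact: cu.
Qed.

Theorem proposition10p1 (R : realType) (h : R) (h_gt0 : 0 < h) :
  [/\ (forall n : nat, cvgn (partial_prod (@prodk_factor R n))),
      cvgn (partial_prod (@prodl_factor R)),
      cvgn (series (C1_term h)) &
      (\int[@lebesgue_measure R]_x
          (expR (- (1 / (4 * h)) * x ^+ 4 + 1 / (2 * h) * x ^+ 2))%:E
       = (C1 h * (Num.sqrt (h `^ (1 / 2) * 2 `^ (1 / 2) * pi `^ (3 / 2))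
                  / (AGM (Num.sqrt 2) 1) `^ (1 / 2)))%:E)%E].
Proof.
pose k := 1 / (4 * h); have k0 : 0 < k by rewrite divr_gt0 ?mulr_gt0.
pose l := 1 / (2 * h); have l0 : 0 < l by rewrite divr_gt0 ?mulr_gt0.
have m0 : 0 < quartic_moment k 0 by rewrite quartic_moment_gt0.
have [L0 [L00 P0 Q0 P1]] := prodk_cvg k0.
pose J := (\int[mu]_(x in `[0%R, +oo[)
             (expR (l * x ^+ 2) * quartic_weight k x)%:E)%E.
have J0 : (0 <= J)%E.
  by apply: integral_ge0 => x _; rewrite lee_fin mulr_ge0 ?expR_ge0.
have Jfin : J \is a fin_num by rewrite ge0_fin_numE// quartic_integral_lty.
pose S := fine J; have JS : J = S%:E by rewrite fineK.
have cS : series (fun n => l ^+ n / n`!%:R * quartic_moment k n) @ \oo --> S.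
  apply: ge0_cvg_series => [n|]; last first.
    by rewrite -integral_moment_series// ?(ltW l0).
  by rewrite mulr_ge0 ?quartic_moment_ge0// divr_ge0// exprn_ge0// ltW.
have cC : series (C1_term h) @ \oo --> S / quartic_moment k 0.
  rewrite (_ : series _ = (fun N =>
      series (fun n => l ^+ n / n`!%:R * quartic_moment k n) N /
      quartic_moment k 0)).
    by apply: cvgM => //; exact: cvg_cst.
  apply/funext => N; rewrite /series/= mulr_suml; apply: eq_bigr => n _.
  exact: C1_termE.
split.
- move=> n; have [L [PL _]] := radicand_limit n k0 L00 P0 P1.
  by apply/cvg_ex; exists L.
- by apply/cvg_ex; eexists; exact: Q0.
- by apply/cvg_ex; eexists; exact: cC.
rewrite /C1 (cvg_lim _ cC)//.
rewrite quartic_moment0_closed_form//.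
transitivity (2%:E * J)%E; last first.
  by rewrite JS -EFinM; congr _%:E; field; rewrite gt_eqF.
rewrite ge0_symfun_integralT.
- rewrite -set_itvcy; congr (_ * _)%E; apply: eq_integral => x _.
  by rewrite /quartic_weight -expRD addrC mulNr.
- by move=> x; exact: expR_ge0.
- move=> x; apply: (@continuous_comp _ _ _ (fun x : R =>
    - (1 / (4 * h)) * x ^+ 4 + 1 / (2 * h) * x ^+ 2) expR).
    by apply: cvgD; apply: cvgM; [exact: cvg_cst|exact: exprn_continuous|
      exact: cvg_cst|exact: exprn_continuous].
  exact: continuous_expR.
- by move=> x /=; congr expR; ring.
Qed.
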